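(* Let $A$ be a pseudo-BCK algebra and let $v_1, v_2$ be very true operators on $A$. If $\mathrm{Im}(v_1)=\mathrm{Im}(v_2)$, then $v_1=v_2$.
   Context: A pseudo-BCK algebra is a structure $(A,\leq,\rightarrow,\rightsquigarrow,1)$ where $\leq$ is a binary relation on $A$, $\rightarrow$ and $\rightsquigarrow$ are binary operations on $A$ and $1\in A$, such that for all $x,y,z\in A$: $x\rightarrow y\leq (y\rightarrow z)\rightsquigarrow (x\rightarrow z)$ and $x\rightsquigarrow y\leq (y\rightsquigarrow z)\rightarrow (x\rightsquigarrow z)$; $x\leq (x\rightarrow y)\rightsquigarrow y$ and $x\leq (x\rightsquigarrow y)\rightarrow y$; $x\leq x$; $x\leq 1$; if $x\leq y$ and $y\leq x$ then $x=y$; $x\leq y$ iff $x\rightarrow y=1$ iff $x\rightsquigarrow y=1$. A very true operator on a pseudo-BCK algebra $A$ is a map $v:A\to A$ such that for all $x,y\in A$: $v(1)=1$; $v(x)\leq x$; $v(x)\leq v(v(x))$; $v(x\rightarrow y)\leq v(x)\rightarrow v(y)$ and $v(x\rightsquigarrow y)\leq v(x)\rightsquigarrow v(y)$. $\mathrm{Im}(v)$ denotes the image $\{v(x)\mid x\in A\}$. *)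

(* Defs.v *)
From mathcomp Require Import all_boot.
From mathcomp Require Import boolp classical_sets.
Set Implicit Arguments.
Unset Strict Implicit.
Unset Printing Implicit Defensive.

Declare Scope pbck_scope.
Delimit Scope pbck_scope with pbck.

Reserved Notation "x ⊑ y" (at level 70, no associativity).
Reserved Notation "x ⟶ y" (at level 60, right associativity).
Reserved Notation "x ⇝ y" (at level 60, right associativity).

(* [bck_le] is only assumed to be a binary relation: transitivity is a
   consequence of the axioms, not one of them. *)
Record pseudoBCK : Type := PseudoBCK {
  carrier :> Type;
  bck_le : carrier -> carrier -> Prop where "x ⊑ y" := (bck_le x y);
  bck_imp : carrier -> carrier -> carrier where "x ⟶ y" := (bck_imp x y);
  bck_simp : carrier -> carrier -> carrier where "x ⇝ y" := (bck_simp x y);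
  bck_one : carrier;
  bck_imp_suffix : forall x y z, x ⟶ y ⊑ (y ⟶ z) ⇝ (x ⟶ z);
  bck_simp_suffix : forall x y z, x ⇝ y ⊑ (y ⇝ z) ⟶ (x ⇝ z);
  bck_imp_assert : forall x y, x ⊑ (x ⟶ y) ⇝ y;
  bck_simp_assert : forall x y, x ⊑ (x ⇝ y) ⟶ y;
  bck_le_refl : forall x, x ⊑ x;
  bck_le_one : forall x, x ⊑ bck_one;
  bck_le_antisym : forall x y, x ⊑ y -> y ⊑ x -> x = y;
  bck_le_imp : forall x y, x ⊑ y <-> x ⟶ y = bck_one;
  bck_le_simp : forall x y, x ⊑ y <-> x ⇝ y = bck_one
}.

Arguments bck_le {p} x y.
Arguments bck_imp {p} x y.
Arguments bck_simp {p} x y.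
Arguments bck_one {p}.

Notation "x ⊑ y" := (bck_le x y) : pbck_scope.
Notation "x ⟶ y" := (bck_imp x y) : pbck_scope.
Notation "x ⇝ y" := (bck_simp x y) : pbck_scope.

Local Open Scope pbck_scope.

Record very_true (A : pseudoBCK) (v : A -> A) : Prop := VeryTrue {
  vt_one : v bck_one = bck_one;
  vt_le : forall x, v x ⊑ x;
  vt_idem : forall x, v x ⊑ v (v x);
  vt_imp : forall x y, v (x ⟶ y) ⊑ v x ⟶ v y;
  vt_simp : forall x y, v (x ⇝ y) ⊑ v x ⇝ v y
}.

(* Main.v *)
Require Import Defs.
From mathcomp Require Import all_boot.
From mathcomp Require Import boolp classical_sets.

(** A very true operator [v] is an interior operator: it is contractive,
    monotone and idempotent.  Hence [v x] is the greatest element of [range v]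
    below [x] ([vt_le], [very_true_greatest]), and such an element is
    determined by the set [range v] alone.  If two operators have the same
    range, each of [v1 x] and [v2 x] therefore lies below the other, and
    antisymmetry concludes. *)

Local Open Scope pbck_scope.

Lemma bck_one_le {A : pseudoBCK} (x : A) : bck_one ⊑ x -> x = bck_one.
Proof. by move=> le1x; apply: bck_le_antisym => //; apply: bck_le_one. Qed.

(** The order is encoded by the implication: [x ⊑ y] makes [x ⟶ y] equal to
    [bck_one], which [v] fixes, so [vt_imp] puts [bck_one] below
    [v x ⟶ v y]. *)
Lemma very_true_mono {A : pseudoBCK} {v : A -> A} {x y : A} :
  very_true v -> x ⊑ y -> v x ⊑ v y.
Proof.
move=> hv /bck_le_imp xy1; apply/bck_le_imp/bck_one_le.
by rewrite -[X in X ⊑ _](vt_one hv) -xy1; apply: (vt_imp hv).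
Qed.

Lemma very_true_idem {A : pseudoBCK} {v : A -> A} (x : A) :
  very_true v -> v (v x) = v x.
Proof.
by move=> hv; apply: bck_le_antisym; [apply: (vt_le hv)|apply: (vt_idem hv)].
Qed.

(** Idempotence makes elements of the range fixed points of [v], so applying
    the monotone [v] to [y ⊑ x] leaves the left-hand side unchanged. *)
Lemma very_true_greatest {A : pseudoBCK} {v : A -> A} {x y : A} :
  very_true v -> range v y -> y ⊑ x -> y ⊑ v x.
Proof.
move=> hv [z _ <-] vzx.
by rewrite -(very_true_idem z hv); apply: very_true_mono.
Qed.

Theorem theorem4p9 (A : pseudoBCK) (v1 v2 : A -> A)
    (hv1 : very_true v1) (hv2 : very_true v2)
    (him : range v1 = range v2) : v1 = v2.
Proof.
apply: funext => x; apply: bck_le_antisym.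
- apply: (very_true_greatest hv2); last exact: (vt_le hv1).
  by rewrite -him; exists x.
- apply: (very_true_greatest hv1); last exact: (vt_le hv2).
  by rewrite him; exists x.
Qed.
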